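(* Consider the discrete-time LTI system $x[t+1]=Ax[t]+B_2u[t]+\delta_x[t]$ evolving under a dynamic state-feedback control policy $\mathbf{u}=\mathbf{K}\mathbf{x}$. The following statements are true. 1. The affine subspace defined by $$\begin{bmatrix} zI-A & -B_2\end{bmatrix}\begin{bmatrix}\mathbf{\Phi}_x\\ \mathbf{\Phi}_u\end{bmatrix}=I,\qquad \mathbf{\Phi}_x,\mathbf{\Phi}_u\in\tfrac{1}{z}\mathcal{RH}_\infty$$ parameterizes all system responses from $\boldsymbol{\delta}_x$ to $(\mathbf{x},\mathbf{u})$, $\mathbf{\Phi}_x=(zI-A-B_2\mathbf{K})^{-1}$, $\mathbf{\Phi}_u=\mathbf{K}(zI-A-B_2\mathbf{K})^{-1}$, achievable by an internally stabilizing state-feedback controller $\mathbf{K}$; that is, a pair $\{\mathbf{\Phi}_x,\mathbf{\Phi}_u\}$ lies in this affine subspace if and only if it is the system response achieved by some internally stabilizing $\mathbf{K}$. 2. For any transfer matrices $\{\mathbf{\Phi}_x,\mathbf{\Phi}_u\}$ in this affine subspace, the controller $\mathbf{K}=\mathbf{\Phi}_u\mathbf{\Phi}_x^{-1}$, implemented via $$\mathbf{u}=z\mathbf{\Phi}_u\hat{\boldsymbol{\delta}}_x,\qquad \hat{\boldsymbol{\delta}}_x=\mathbf{x}+(I-z\mathbf{\Phi}_x)\hat{\boldsymbol{\delta}}_x,$$ is internally stabilizing and achieves the desired system response, i.e. $\mathbf{x}=\mathbf{\Phi}_x\boldsymbol{\delta}_x$ and $\mathbf{u}=\mathbf{\P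hi}_u\boldsymbol{\delta}_x$.
   Context: Here $x[t]$ is the state, $u[t]$ the control input and $\delta_x[t]$ the disturbance on the state; $A,B_2$ are real matrices of compatible dimensions. Boldface denotes $z$-transforms of signals and transfer matrices, so $(zI-A)\mathbf{x}=B_2\mathbf{u}+\boldsymbol{\delta}_x$. $\mathcal{RH}_\infty$ is the set of stable (all poles in $|z|<1$) real-rational proper transfer matrices; $\mathbf{G}\in\frac1z\mathcal{RH}_\infty$ means $z\mathbf{G}\in\mathcal{RH}_\infty$ (stable and strictly proper). Controllers $\mathbf{K}$ are proper real-rational transfer matrices with a stabilizable and detectable state-space realization, and $\mathbf{K}$ is internally stabilizing if the interconnection of plant and controller is internally stable (closed-loop state matrix has all eigenvalues in $|z|<1$). For the implementation in part 2, internal stability means the following: with external perturbations $\boldsymbol{\delta}_x,\boldsymbol{\delta}_y,\boldsymbol{\delta}_u$ injected on the state, the measurement and the control action, i.e. $$(zI-A)\mathbf{x}=B_2\mathbf{u}+\boldsymbol{\delta}_x,\qquad \mathbf{u}=z\mathbf{\Phi}_u\hat{\boldsymbol{\delta}}_x+\boldsymbol{\delta}_u,\qquad \hat{\boldsymbol{\delta}}_x=\mathbf{x}+\boldsymbol{\delta}_y+(I-z\mathbf{\Phi}_x)\hat{\boldsymbol{\delta}}_x,$$ all nine closed-loop transfer matrices from $(\boldsymbol{\delta}_x,\boldsymbol{\delta}_y,\boldsymbol{\delta}_u)$ to $(\mathbf{x},\mathbf{u},\hat{\boldsymbol{\delta}}_x)$ belong to $\mathcal{RH}_\infty$. *)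

(* Defs.v *)
From HB Require Import structures.
From mathcomp Require Import all_boot all_order all_algebra.
From mathcomp Require Import complex reals.

Set Implicit Arguments.
Unset Strict Implicit.
Unset Printing Implicit Defensive.

Import Order.TTheory GRing.Theory Num.Theory.
Local Open Scope ring_scope.

Section TransferFunctions.
Variable R : realType.

Definition ratfun := {fraction {poly R}}.

Definition zvar : ratfun := @tofrac {poly R} 'X.

Definition cst : R -> ratfun := @tofrac {poly R} \o polyC.
HB.instance Definition _ := GRing.RMorphism.on cst.

(* Denominators are required to be nonzero: tofrac p / tofrac 0 is the junk
   value 0. *)
Definition proper (f : ratfun) : Prop :=
  exists p q : {poly R},
    [/\ q != 0, (size p <= size q)%N & f = tofrac p / tofrac q].

(* The poles are the complex zeros of the denominator in lowest terms. *)
Definition pole (f : ratfun) (w : R[i]) : Prop :=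
  exists p q : {poly R},
    [/\ q != 0, coprimep p q, f = tofrac p / tofrac q
      & root (map_poly (real_complex R) q) w].

Definition stable (f : ratfun) : Prop := forall w, pole f w -> `|w| < 1.

Definition RHinf (a b : nat) (G : 'M[ratfun]_(a, b)) : Prop :=
  forall i j, proper (G i j) /\ stable (G i j).

(* (1/z) RHinf *)
Definition zinvRHinf (a b : nat) (G : 'M[ratfun]_(a, b)) : Prop :=
  RHinf (zvar *: G).

Definition zIsub (n : nat) (A : 'M[R]_n) : 'M[ratfun]_n :=
  zvar%:M - map_mx cst A.

Definition schur (n : nat) (A : 'M[R]_n) : Prop :=
  forall w : R[i], eigenvalue (map_mx (real_complex R) A) w -> `|w| < 1.

Definition stabilizable (n m : nat) (A : 'M[R]_n) (B : 'M[R]_(n, m)) : Prop :=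
  exists F : 'M[R]_(m, n), schur (A + B *m F).

Definition detectable (n p : nat) (C : 'M[R]_(p, n)) (A : 'M[R]_n) : Prop :=
  exists L : 'M[R]_(n, p), schur (A + L *m C).

(* xi[t+1] = Ak xi[t] + Bk x[t],  u[t] = Ck xi[t] + Dk x[t]; zIsub Ak is always
   invertible, its determinant being the characteristic polynomial of Ak. *)
Definition realization (n m k : nat) (K : 'M[ratfun]_(m, n))
    (Ak : 'M[R]_k) (Bk : 'M[R]_(k, n)) (Ck : 'M[R]_(m, k)) (Dk : 'M[R]_(m, n))
    : Prop :=
  K = map_mx cst Ck *m invmx (zIsub Ak) *m map_mx cst Bk + map_mx cst Dk.

(* State matrix, in the coordinates (x, xi), of the interconnection of
   x[t+1] = A x[t] + B2 u[t] with the controller above. *)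
Definition closed_loop_matrix (n m k : nat) (A : 'M[R]_n) (B2 : 'M[R]_(n, m))
    (Ak : 'M[R]_k) (Bk : 'M[R]_(k, n)) (Ck : 'M[R]_(m, k)) (Dk : 'M[R]_(m, n))
    : 'M[R]_(n + k) :=
  block_mx (A + B2 *m Dk) (B2 *m Ck) Bk Ak.

(* A K with a finite-dimensional realization is real-rational and proper. *)
Definition internally_stabilizing (n m : nat) (A : 'M[R]_n)
    (B2 : 'M[R]_(n, m)) (K : 'M[ratfun]_(m, n)) : Prop :=
  exists (k : nat) (Ak : 'M[R]_k) (Bk : 'M[R]_(k, n)) (Ck : 'M[R]_(m, k))
         (Dk : 'M[R]_(m, n)),
    [/\ realization K Ak Bk Ck Dk, stabilizable Ak Bk, detectable Ck Ak
      & schur (closed_loop_matrix A B2 Ak Bk Ck Dk)].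

(* The unitmx conjunct only guards against the junk value of invmx: it holds
   for every proper K. *)
Definition system_response (n m : nat) (A : 'M[R]_n) (B2 : 'M[R]_(n, m))
    (K : 'M[ratfun]_(m, n)) (Phix : 'M[ratfun]_n) (Phiu : 'M[ratfun]_(m, n))
    : Prop :=
  let M := zIsub A - map_mx cst B2 *m K in
  [/\ M \in unitmx, Phix = invmx M & Phiu = K *m invmx M].

Definition affine_subspace (n m : nat) (A : 'M[R]_n) (B2 : 'M[R]_(n, m))
    (Phix : 'M[ratfun]_n) (Phiu : 'M[ratfun]_(m, n)) : Prop :=
  [/\ row_mx (zIsub A) (- map_mx cst B2) *m col_mx Phix Phiu = 1%:M,
      zinvRHinf Phix & zinvRHinf Phiu].

End TransferFunctions.

(* The z-transforms of signals take their coordinates in an arbitrary field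
   extension iota : ratfun R -> L. This covers rational signals (L = ratfun R)
   as well as arbitrary one-sided sequences (L = formal Laurent series in 1/z);
   transfer matrices act through iota. *)
Section Signals.
Variables (R : realType) (L : fieldType) (iota : {rmorphism ratfun R -> L}).

Definition tfapp (a b : nat) (G : 'M[ratfun R]_(a, b)) (s : 'cV[L]_b)
  : 'cV[L]_a := map_mx iota G *m s.

Definition implementation (n m : nat)
    (Phix : 'M[ratfun R]_n) (Phiu : 'M[ratfun R]_(m, n))
    (x : 'cV[L]_n) (u : 'cV[L]_m) (dhat : 'cV[L]_n) : Prop :=
  u = tfapp (zvar R *: Phiu) dhat /\
  dhat = x + tfapp (1%:M - zvar R *: Phix) dhat.

Definition perturbed_loop (n m : nat) (A : 'M[R]_n) (B2 : 'M[R]_(n, m))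
    (Phix : 'M[ratfun R]_n) (Phiu : 'M[ratfun R]_(m, n))
    (dx dy : 'cV[L]_n) (du : 'cV[L]_m)
    (x : 'cV[L]_n) (u : 'cV[L]_m) (dhat : 'cV[L]_n) : Prop :=
  [/\ tfapp (zIsub A) x = tfapp (map_mx (@cst R) B2) u + dx,
      u = tfapp (zvar R *: Phiu) dhat + du
    & dhat = x + dy + tfapp (1%:M - zvar R *: Phix) dhat].

End Signals.

Definition implements (R : realType) (n m : nat)
    (Phix : 'M[ratfun R]_n) (Phiu : 'M[ratfun R]_(m, n))
    (K : 'M[ratfun R]_(m, n)) : Prop :=
  forall (L : fieldType) (iota : {rmorphism ratfun R -> L})
         (x : 'cV[L]_n) (u : 'cV[L]_m),
    (exists dhat, implementation iota Phix Phiu x u dhat) <-> u = tfapp iota K x.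

(* The equivalence includes well-posedness: for all perturbations the loop
   equations have exactly one solution (x, u, dhat). *)
Definition implementation_internally_stable (R : realType) (n m : nat)
    (A : 'M[R]_n) (B2 : 'M[R]_(n, m))
    (Phix : 'M[ratfun R]_n) (Phiu : 'M[ratfun R]_(m, n)) : Prop :=
  exists (Txx Txy : 'M[ratfun R]_n) (Txu : 'M[ratfun R]_(n, m))
         (Tux Tuy : 'M[ratfun R]_(m, n)) (Tuu : 'M[ratfun R]_m)
         (Tdx Tdy : 'M[ratfun R]_n) (Tdu : 'M[ratfun R]_(n, m)),
    (forall (L : fieldType) (iota : {rmorphism ratfun R -> L})
            (dx dy : 'cV[L]_n) (du : 'cV[L]_m)
            (x : 'cV[L]_n) (u : 'cV[L]_m) (dhat : 'cV[L]_n),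
       perturbed_loop iota A B2 Phix Phiu dx dy du x u dhat <->
       [/\ x = tfapp iota Txx dx + tfapp iota Txy dy + tfapp iota Txu du,
           u = tfapp iota Tux dx + tfapp iota Tuy dy + tfapp iota Tuu du
         & dhat = tfapp iota Tdx dx + tfapp iota Tdy dy + tfapp iota Tdu du])
    /\ [/\ RHinf Txx, RHinf Txy & RHinf Txu]
    /\ [/\ RHinf Tux, RHinf Tuy & RHinf Tuu]
    /\ [/\ RHinf Tdx, RHinf Tdy & RHinf Tdu].

Definition achieves_response (R : realType) (n m : nat)
    (A : 'M[R]_n) (B2 : 'M[R]_(n, m))
    (Phix : 'M[ratfun R]_n) (Phiu : 'M[ratfun R]_(m, n)) : Prop :=
  forall (L : fieldType) (iota : {rmorphism ratfun R -> L})
         (dx : 'cV[L]_n) (x : 'cV[L]_n) (u : 'cV[L]_m) (dhat : 'cV[L]_n),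
    tfapp iota (zIsub A) x = tfapp iota (map_mx (@cst R) B2) u + dx ->
    implementation iota Phix Phiu x u dhat ->
    x = tfapp iota Phix dx /\ u = tfapp iota Phiu dx.

(* Main.v *)
Require Import Defs.
From mathcomp Require Import all_boot all_order all_algebra.
From mathcomp Require Import complex reals.
From mathcomp Require Import boolp perm mxpoly ring.

Set Implicit Arguments.
Unset Strict Implicit.
Unset Printing Implicit Defensive.

Import Order.TTheory GRing.Theory Num.Theory.
Local Open Scope ring_scope.

(* Achieved responses are corner blocks of the resolvent of the Schur closed-loop
   matrix, hence lie in (1/z) RHinf.

   Conversely, let (Phix, Phiu) lie in the affine subspace.  Evaluating the
   identity at an unstable point shows that (A, B2) passes the Hautus test, and
   moving unstable eigenvalues (or conjugate pairs) of A to 0 one at a time gives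
   a static F with A + B2 F Schur.  Then Q = z Phiu - F (z Phix - I) is stable and
   has a realization (Aq, Bq, Cq, Dq) with Aq Schur.  The controller
     xhat[t+1] = A x[t] + B2 u[t],   u = F xhat + Q (x - xhat)
   realizes the desired response: x - xhat is the delayed disturbance.  In the
   coordinates (x - xhat, xhat, q) the closed loop is block triangular with
   diagonal blocks 0, A + B2 F, Aq.  The controller is stabilized by the feedback
   x = xhat and detected by the output injection -B2 into xhat.

   In the implementation of part 2, z dhat = dx + (zI - A) dy + B2 du, and the
   nine closed-loop maps can be read off. *)

Local Notation cmx := (map_mx (@cst _)).

(** * Schur polynomials and Schur matrices *)

Definition schur_poly (R : realType) (q : {poly R}) : Prop :=
  forall w : R[i], root (map_poly (real_complex R) q) w -> `|w| < 1.

Lemma schur_poly_neq0 (R : realType) (q : {poly R}) : schur_poly q -> q != 0.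
Proof.
move=> hq; apply/eqP => q0.
by have := hq 1; rewrite q0 rmorph0 root0 normr1 ltxx => /(_ isT).
Qed.

Lemma schur_polyM (R : realType) (p q : {poly R}) :
  schur_poly (p * q) <-> schur_poly p /\ schur_poly q.
Proof.
rewrite /schur_poly; split=> [h | [hp hq] w].
  by split=> w r; apply: h; rewrite rmorphM rootM r ?orbT.
by rewrite rmorphM rootM => /orP[/hp|/hq].
Qed.

Lemma schur_poly_dvdp (R : realType) (p q : {poly R}) :
  p %| q -> schur_poly q -> schur_poly p.
Proof. by move=> /dvdpP[k ->] /schur_polyM[]. Qed.

Lemma schur_polyXn (R : realType) (k : nat) : schur_poly ('X^k : {poly R}).
Proof.
move=> w; rewrite map_polyXn rootE hornerXn expf_eq0 => /andP[_ /eqP->].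
by rewrite normr0 ltr01.
Qed.

Lemma schur_polyC (R : realType) (c : R) : c != 0 -> schur_poly c%:P.
Proof.
by move=> c0 w; rewrite map_polyC rootC fmorph_eq0 (negPf c0).
Qed.

Lemma schur_polyX (R : realType) : schur_poly ('X : {poly R}).
Proof. by rewrite -['X]expr1; apply: schur_polyXn. Qed.

Lemma schurE (R : realType) (n : nat) (A : 'M[R]_n) :
  schur A <-> schur_poly (char_poly A).
Proof.
by split=> h w hw; apply: h; move: hw; rewrite map_char_poly eigenvalue_root_char.
Qed.

Lemma char_poly_ublock (R : comNzRingType) (n k : nat) (A : 'M[R]_n)
    (B : 'M[R]_(n, k)) (D : 'M[R]_k) :
  char_poly (block_mx A B 0 D) = char_poly A * char_poly D.
Proof.
rewrite /char_poly -(det_ublock _ (- map_mx polyC B)); congr (\det _).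
by rewrite /char_poly_mx map_block_mx map_mx0 scalar_mx_block opp_block_mx
  add_block_mx oppr0 addr0 add0r.
Qed.

Lemma char_poly_lblock (R : comNzRingType) (n k : nat) (A : 'M[R]_n)
    (C : 'M[R]_(k, n)) (D : 'M[R]_k) :
  char_poly (block_mx A 0 C D) = char_poly A * char_poly D.
Proof.
rewrite /char_poly -(det_lblock _ (- map_mx polyC C)); congr (\det _).
by rewrite /char_poly_mx map_block_mx map_mx0 scalar_mx_block opp_block_mx
  add_block_mx oppr0 addr0 add0r.
Qed.

Lemma schur_ublock (R : realType) (n k : nat) (A : 'M[R]_n)
    (B : 'M[R]_(n, k)) (D : 'M[R]_k) :
  schur A -> schur D -> schur (block_mx A B 0 D).
Proof. by rewrite !schurE char_poly_ublock schur_polyM. Qed.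

Lemma schur_lblock (R : realType) (n k : nat) (A : 'M[R]_n)
    (C : 'M[R]_(k, n)) (D : 'M[R]_k) :
  schur A -> schur D -> schur (block_mx A 0 C D).
Proof. by rewrite !schurE char_poly_lblock schur_polyM. Qed.

Lemma schur0 (R : realType) (n : nat) : schur (0 : 'M[R]_n).
Proof.
rewrite schurE /char_poly /char_poly_mx map_mx0 subr0 det_scalar.
exact: schur_polyXn.
Qed.

Lemma schur_conj (R : realType) (n : nat) (T M N : 'M[R]_n) :
  T \in unitmx -> T *m M = N *m T -> schur N -> schur M.
Proof.
move=> Tu TM hN w /eigenvalueP[v vM v0]; apply: hN.
set c := map_mx (real_complex R) in vM *.
have cTu : c T \in unitmx by rewrite map_unitmx.
apply/eigenvalueP; exists (v *m invmx (c T)); last first.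
  by apply: contraNneq v0 => v0; rewrite -(mulmxKV cTu v) v0 mul0mx.
apply: (can_inj (mulmxK cTu)).
have cTM : c T *m c M = c N *m c T by rewrite /c -!map_mxM TM.
by rewrite /= -(mulmxA _ (c N)) -cTM mulmxA mulmxKV // vM -scalemxAl mulmxKV.
Qed.

(** * The ring of stable proper rational functions, and matrices over it *)

Definition RHfun (R : realType) (f : ratfun R) : Prop :=
  exists p q : {poly R},
    [/\ schur_poly q, (size p <= size q)%N & f = tofrac p / tofrac q].

Lemma tofrac_cross (D : idomainType) (a b c d : D) : b != 0 -> d != 0 ->
  tofrac a / tofrac b = tofrac c / tofrac d -> a * d = c * b.
Proof.
move=> b0 d0 /eqP; rewrite eqr_div ?tofrac_eq0 // -!tofracM tofrac_eq.
by move/eqP.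
Qed.

(** [RHfun] accepts any fraction with a Schur denominator, reduced or not, which makes closure under
    sums and products direct. To reach it, cancel the gcd: both degrees drop equally, and the roots
    of the reduced denominator are poles. Conversely, by Gauss the denominator of a reduced form
    divides every other denominator, so all poles are roots of [q]. *)
Lemma RHfunP (R : realType) (f : ratfun R) :
  Defs.proper f /\ stable f <-> RHfun f.
Proof.
split=> [[[p [q [q0 sz fE]]] st] | [p [q [hq sz fE]]]]; last first.
  have q0 := schur_poly_neq0 hq.
  split; first by exists p, q.
  move=> w [p' [q' [q'0 cop fE' rt]]].
  suff: q' %| q by move/schur_poly_dvdp => /(_ hq); apply.
  rewrite fE in fE'; have e := tofrac_cross q0 q'0 fE'.
  rewrite -(Gauss_dvdpr _ (q := p')); last by rewrite coprimep_sym.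
  by rewrite -e dvdp_mull.
pose g := gcdp p q.
have g0 : g != 0 by rewrite gcdp_eq0 (negPf q0) andbF.
have pE : p = p %/ g * g by rewrite divpK ?dvdp_gcdl.
have qE : q = q %/ g * g by rewrite divpK ?dvdp_gcdr.
have q'0 : q %/ g != 0 by apply: contraNneq q0 => h; rewrite qE h mul0r.
have fE' : f = tofrac (p %/ g) / tofrac (q %/ g).
  rewrite fE {1}pE {1}qE !tofracM -mulf_div divff ?mulr1 //.
  by rewrite tofrac_eq0.
exists (p %/ g), (q %/ g); split=> //; last first.
  by rewrite !size_divp // leq_sub2r.
move=> w rw; apply: st; exists (p %/ g), (q %/ g); split=> //.
by rewrite coprimep_div_gcd // q0 orbT.
Qed.

Lemma RHinfP (R : realType) (a b : nat) (G : 'M[ratfun R]_(a, b)) :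
  RHinf G <-> forall i j, RHfun (G i j).
Proof. by split=> h i j; apply/RHfunP. Qed.

Lemma leq_size_mul (R : idomainType) (p p' q q' : {poly R}) :
  q != 0 -> q' != 0 -> (size p <= size q)%N -> (size p' <= size q')%N ->
  (size (p * p')%R <= size (q * q')%R)%N.
Proof.
move=> q0 q'0 h h'; rewrite (size_mul q0 q'0).
by apply: leq_trans (size_polyMleq _ _) _; rewrite -!subn1 leq_sub2r ?leq_add.
Qed.

Lemma RHfunD (R : realType) (f g : ratfun R) :
  RHfun f -> RHfun g -> RHfun (f + g).
Proof.
move=> [p [q [hq s ->]]] [p' [q' [hq' s' ->]]].
have [q0 q'0] := (schur_poly_neq0 hq, schur_poly_neq0 hq').
exists (p * q' + p' * q), (q * q'); split; first exact/schur_polyM.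
  apply: leq_trans (size_polyD _ _) _; rewrite geq_max.
  by rewrite leq_size_mul //= mulrC leq_size_mul.
by rewrite addf_div ?tofrac_eq0 // -!tofracM -tofracD.
Qed.

Lemma RHfunM (R : realType) (f g : ratfun R) :
  RHfun f -> RHfun g -> RHfun (f * g).
Proof.
move=> [p [q [hq s ->]]] [p' [q' [hq' s' ->]]].
have [q0 q'0] := (schur_poly_neq0 hq, schur_poly_neq0 hq').
exists (p * p'), (q * q'); split; first exact/schur_polyM.
  exact: leq_size_mul.
by rewrite mulf_div -!tofracM.
Qed.

Lemma RHfun_cst (R : realType) (c : R) : RHfun (cst c).
Proof.
exists c%:P, 1; split; last by rewrite tofrac1 divr1.
  by apply: schur_polyC; rewrite oner_eq0.
by rewrite size_poly1 size_polyC_leq1.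
Qed.

Lemma RHfun0 (R : realType) : RHfun (0 : ratfun R).
Proof. by rewrite -(rmorph0 (@cst R)); apply: RHfun_cst. Qed.

Lemma RHfun_zvarV (R : realType) : RHfun (zvar R)^-1.
Proof.
exists 1, 'X; split; first exact: schur_polyX.
  by rewrite size_poly1 size_polyX.
by rewrite tofrac1 div1r.
Qed.

Lemma zvar_neq0 (R : realType) : zvar R != 0.
Proof. by rewrite tofrac_eq0 polyX_eq0. Qed.

Lemma RHinf_cst (R : realType) (a b : nat) (M : 'M[R]_(a, b)) :
  RHinf (map_mx (@cst R) M).
Proof. by apply/RHinfP => i j; rewrite mxE; apply: RHfun_cst. Qed.

Lemma RHinfD (R : realType) (a b : nat) (G H : 'M[ratfun R]_(a, b)) :
  RHinf G -> RHinf H -> RHinf (G + H).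
Proof.
by move=> /RHinfP hG /RHinfP hH; apply/RHinfP => i j; rewrite mxE; apply: RHfunD.
Qed.

Lemma RHinfM (R : realType) (a b c : nat) (G : 'M[ratfun R]_(a, b))
    (H : 'M[ratfun R]_(b, c)) : RHinf G -> RHinf H -> RHinf (G *m H).
Proof.
move=> /RHinfP hG /RHinfP hH; apply/RHinfP => i j; rewrite mxE.
apply: (big_ind (@RHfun R)); [exact: RHfun0 | exact: RHfunD |].
by move=> k _; apply: RHfunM.
Qed.

Lemma RHinfZ (R : realType) (a b : nat) (f : ratfun R) (G : 'M[ratfun R]_(a, b)) :
  RHfun f -> RHinf G -> RHinf (f *: G).
Proof.
move=> hf /RHinfP hG; apply/RHinfP => i j; rewrite mxE; exact: RHfunM.
Qed.

Lemma RHinf1 (R : realType) (n : nat) : RHinf (1%:M : 'M[ratfun R]_n).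
Proof. by rewrite -(map_mx1 (@cst R)); apply: RHinf_cst. Qed.

Lemma RHinfN (R : realType) (a b : nat) (G : 'M[ratfun R]_(a, b)) :
  RHinf G -> RHinf (- G).
Proof.
move=> hG; rewrite -scaleN1r -(rmorph1 (@cst R)) -rmorphN.
by apply: RHinfZ => //; apply: RHfun_cst.
Qed.

Lemma zinvRHinf_RHinf (R : realType) (a b : nat) (G : 'M[ratfun R]_(a, b)) :
  zinvRHinf G -> RHinf G.
Proof.
move=> /(RHinfZ (RHfun_zvarV R)).
by rewrite scalerA mulVf ?zvar_neq0 // scale1r.
Qed.

Lemma RHinf_col_mx (R : realType) (a b c : nat) (G : 'M[ratfun R]_(a, c))
    (H : 'M[ratfun R]_(b, c)) : RHinf G -> RHinf H -> RHinf (col_mx G H).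
Proof.
move=> hG hH i j; rewrite mxE; case: split => k; [exact: hG | exact: hH].
Qed.

(** * Resolvents and closed-loop responses *)

Lemma zIsubE (R : realType) (n : nat) (A : 'M[R]_n) :
  zIsub A = map_mx (@FracField.tofrac _) (char_poly_mx A).
Proof. by rewrite /zIsub map_mxB map_scalar_mx -map_mx_comp. Qed.

Lemma det_zIsub (R : realType) (n : nat) (A : 'M[R]_n) :
  \det (zIsub A) = tofrac (char_poly A).
Proof. by rewrite zIsubE det_map_mx. Qed.

Lemma zIsub_unit (R : realType) (n : nat) (A : 'M[R]_n) : zIsub A \in unitmx.
Proof.
rewrite unitmxE det_zIsub unitfE tofrac_eq0.
exact: monic_neq0 (char_poly_monic A).
Qed.

Lemma leq_size_det (R : comNzRingType) (n : nat) (M : 'M[{poly R}]_n) :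
  (forall i j, (size (M i j) <= 2)%N) -> (size (\det M) <= n.+1)%N.
Proof.
move=> hM; rewrite /determinant; apply: leq_trans (size_sum _ _ _) _.
apply/bigmax_leqP => s _; rewrite -polyCN -!polyC_exp mul_polyC.
apply: leq_trans (size_scale_leq _ _) _.
apply: leq_trans (size_prod_leq _ _) _.
have : (\sum_i size (M i (s i)) <= n * 2)%N.
  rewrite -[X in (X * 2)%N]card_ord -sum_nat_const.
  by apply: leq_sum => i _.
by rewrite card_ord leq_subLR muln2 -addnn addnS ltnS.
Qed.

(** Adjugate formula: an entry is a cofactor of zI - A over the characteristic polynomial. The
    cofactor has degree at most n - 1, so the extra factor z keeps the quotient proper. *)
Lemma schur_resolvent (R : realType) (n : nat) (A : 'M[R]_n) :
  schur A -> zinvRHinf (invmx (zIsub A)).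
Proof.
move=> /schurE hA; apply/RHinfP => i j.
rewrite /invmx zIsub_unit !mxE det_zIsub zIsubE cofactor_map_mx.
exists ('X * cofactor (char_poly_mx A) j i), (char_poly A); split=> //.
  case: n A hA i j => [|n] A hA i j; first by case: i.
  rewrite size_char_poly; apply: leq_trans (size_polyMleq _ _) _.
  rewrite size_polyX /cofactor -polyCN -polyC_exp mul_polyC /= ltnS.
  apply: leq_trans (size_scale_leq _ _) _.
  apply: leq_size_det => k l; rewrite !mxE.
  apply: leq_trans (size_polyD _ _) _; rewrite geq_max size_polyN.
  rewrite (leq_trans (size_polyC_leq1 _)) // andbT.
  by case: eqP => _; rewrite ?mulr1n ?mulr0n ?size_polyX ?size_poly0.
by rewrite tofracM -mulrA [X in _ = _ * X]mulrC.
Qed.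

Lemma zIsub_block (R : realType) (n k : nat) (A : 'M[R]_n) (B : 'M[R]_(n, k))
    (C : 'M[R]_(k, n)) (D : 'M[R]_k) :
  zIsub (block_mx A B C D)
  = block_mx (zIsub A) (- cmx B) (- cmx C) (zIsub D).
Proof.
by rewrite /zIsub map_block_mx scalar_mx_block opp_block_mx add_block_mx !add0r.
Qed.

Lemma zIsubD (R : realType) (n : nat) (A B : 'M[R]_n) :
  zIsub (A + B) = zIsub A - cmx B.
Proof. by rewrite /zIsub map_mxD opprD addrA. Qed.

Lemma affine_subspaceE (R : realType) (n m : nat) (A : 'M[R]_n)
    (B : 'M[R]_(n, m)) (Px : 'M[ratfun R]_n) (Pu : 'M[ratfun R]_(m, n)) :
  row_mx (zIsub A) (- cmx B) *m col_mx Px Pu = zIsub A *m Px - cmx B *m Pu.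
Proof. by rewrite mul_row_col mulNmx. Qed.

Lemma closed_loop_response (R : realType) (n m : nat) (A : 'M[R]_n)
    (B2 : 'M[R]_(n, m)) (K : 'M[ratfun R]_(m, n)) :
  internally_stabilizing A B2 K -> zIsub A - cmx B2 *m K \in unitmx ->
  zinvRHinf (invmx (zIsub A - cmx B2 *m K)) /\
  zinvRHinf (K *m invmx (zIsub A - cmx B2 *m K)).
Proof.
move=> [k [Ak [Bk [Ck [Dk [KE _ _ hcl]]]]]] uM.
set M := _ - _ in uM *; set Px := invmx M.
pose S := invmx (zIsub Ak) *m cmx Bk.
have ZS : zIsub Ak *m S = cmx Bk by rewrite mulKVmx ?zIsub_unit.
have KE' : K = cmx Dk + cmx Ck *m S by rewrite KE addrC mulmxA.
have MP : M *m Px = 1%:M by rewrite mulmxV.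
have := schur_resolvent hcl.
set Z := zIsub _; set Zi := invmx Z => hZi.
(* [S] is the transfer matrix from x to the controller state, so the left side is the joint response
   of (x, xi) to a disturbance on x alone: the first block column of the closed-loop resolvent. *)
have clE : col_mx Px (S *m Px) = Zi *m col_mx 1%:M 0.
  rewrite -[LHS](mulKmx (zIsub_unit (closed_loop_matrix A B2 Ak Bk Ck Dk))).
  rewrite -/Z -/Zi; congr (_ *m _).
  rewrite /Z zIsub_block mul_block_col; congr col_mx; last first.
    by rewrite mulmxA ZS mulNmx addNr.
  rewrite -MP mulmxA -mulmxDl /M KE' zIsubD; congr (_ *m _).
  by rewrite mulmxDr !map_mxM mulNmx mulmxA opprD addrA.
have hcl' : zinvRHinf (col_mx Px (S *m Px)).
  rewrite /zinvRHinf clE scalemxAl; apply: RHinfM => //.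
  by rewrite -(map_mx1 (@cst R)) -(map_mx0 (@cst R)) -map_col_mx; apply: RHinf_cst.
split.
  have -> : Px = cmx (row_mx 1%:M 0) *m col_mx Px (S *m Px).
    by rewrite map_row_mx mul_row_col map_mx1 map_mx0 mul1mx mul0mx addr0.
  by rewrite /zinvRHinf scalemxAr; apply: RHinfM => //; apply: RHinf_cst.
have -> : K *m Px = cmx (row_mx Dk Ck) *m col_mx Px (S *m Px).
  by rewrite map_row_mx mul_row_col KE' mulmxDl -(mulmxA (cmx Ck)).
by rewrite /zinvRHinf scalemxAr; apply: RHinfM => //; apply: RHinf_cst.
Qed.

(** * The Hautus test for plants with a nonempty affine subspace *)

Lemma RHinf_common_denom (R : realType) (a b : nat) (G : 'M[ratfun R]_(a, b)) :
  RHinf G -> exists (q : {poly R}) (P : 'M[{poly R}]_(a, b)),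
    schur_poly q /\ tofrac q *: G = map_mx (@FracField.tofrac _) P.
Proof.
move=> /RHinfP hG.
have hG' (ij : 'I_a * 'I_b) : exists pq : {poly R} * {poly R},
    schur_poly pq.2 /\ G ij.1 ij.2 = tofrac pq.1 / tofrac pq.2.
  by have [p [q [hq _ e]]] := hG ij.1 ij.2; exists (p, q).
have [f hf] := fin_all_exists hG'.
exists (\prod_ij (f ij).2),
  (\matrix_(i, j) ((f (i, j)).1 * \prod_(kl | kl != (i, j)) (f kl).2)).
split.
  apply: (big_ind (@schur_poly R)) => [|p q hp hq|ij _]; last exact: (hf ij).1.
    by apply: (@schur_polyC R 1); rewrite oner_eq0.
  exact/schur_polyM.
apply/matrixP => i j; rewrite !mxE (bigD1 (i, j)) //= !tofracM.
have [/schur_poly_neq0 q0 /= ->] := hf (i, j).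
by rewrite [X in X * _]mulrC -mulrA [X in _ * X]mulrC divfK ?tofrac_eq0 // mulrC.
Qed.

(* The Popov-Belevitch-Hautus test, on left eigenvectors. *)
Definition pbh_stabilizable (R : realType) (n m : nat) (A : 'M[R]_n)
    (B : 'M[R]_(n, m)) : Prop :=
  forall (w : R[i]) (v : 'rV[R[i]]_n), 1 <= `|w| ->
    v *m map_mx (real_complex R) A = w *: v ->
    v *m map_mx (real_complex R) B = 0 -> v = 0.

(** Clear denominators in the affine identity, evaluate it at z = w and multiply by v on the left.
    The left side vanishes because v(wI - A) = 0 and vB2 = 0; the right side is w q(w) v, where w
    q(w) is nonzero since |w| >= 1 and q is Schur. *)
Lemma affine_subspace_pbh (R : realType) (n m : nat) (A : 'M[R]_n)
    (B2 : 'M[R]_(n, m)) (Phix : 'M[ratfun R]_n) (Phiu : 'M[ratfun R]_(m, n)) :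
  affine_subspace A B2 Phix Phiu -> pbh_stabilizable A B2.
Proof.
move=> [aff hx hu] w v w1 vA vB.
have h : RHinf (zvar R *: col_mx Phix Phiu).
  by rewrite scale_col_mx; apply: RHinf_col_mx.
have [q [P [hq qP]]] := RHinf_common_denom h.
have PE : row_mx (char_poly_mx A) (- map_mx polyC B2) *m P = ('X * q)%:M.
  have inj : injective (@FracField.tofrac {poly R}).
    by move=> p p' /eqP; rewrite tofrac_eq => /eqP.
  suff /matrixP e : map_mx (@FracField.tofrac _)
      (row_mx (char_poly_mx A) (- map_mx polyC B2) *m P)
      = map_mx (@FracField.tofrac _) (('X * q)%:M).
    by apply/matrixP => i j; apply: inj; move: (e i j); rewrite [LHS]mxE [RHS]mxE.
  rewrite map_mxM -qP map_row_mx map_mxN -map_mx_comp -zIsubE -!scalemxAr aff.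
  by rewrite map_scalar_mx !scale_scalar_mx mulr1 /= tofracM [in RHS]mulrC.
pose phi : {rmorphism {poly R} -> R[i]} := horner_eval w \o map_poly (real_complex R).
have phiC c : phi c%:P = real_complex R c by rewrite /phi /= map_polyC horner_evalE hornerC.
have phiX : phi 'X = w by rewrite /phi /= map_polyX horner_evalE hornerX.
have /(congr1 (mulmx v)) := congr1 (map_mx phi) PE.
rewrite map_mxM map_row_mx map_mxN -map_mx_comp (eq_map_mx _ phiC) mulmxA.
rewrite mul_mx_row mulmxN vB oppr0 /char_poly_mx map_mxB -map_mx_comp.
rewrite (eq_map_mx _ phiC) mulmxBr vA !map_scalar_mx phiX mul_mx_scalar subrr.
rewrite row_mx0 mul0mx mul_mx_scalar => /esym/eqP.
rewrite scaler_eq0 => /orP[|/eqP //].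
rewrite rmorphM phiX mulf_eq0 => /orP[/eqP w0|/hq].
  by move: w1; rewrite w0 normr0 ler10.
by move=> /(le_lt_trans w1); rewrite ltxx.
Qed.

(** * Moving unstable eigenvalues to 0 by static feedback *)

Lemma det_1subC (R : comNzRingType) (n k : nat) (X : 'M[R]_(n, k))
    (Y : 'M[R]_(k, n)) : \det (1%:M - X *m Y) = \det (1%:M - Y *m X).
Proof.
(* Both products equal the block matrix with rows (1, X) and (Y, 1). *)
have e : block_mx 1%:M X 0 1%:M *m block_mx (1%:M - X *m Y) 0 Y 1%:M
       = block_mx 1%:M 0 Y 1%:M *m block_mx 1%:M X 0 (1%:M - Y *m X).
  rewrite !mulmx_block !(mul1mx, mulmx1, mul0mx, mulmx0) !(addr0, add0r).
  by rewrite subrK [Y *m X + _]addrC subrK.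
have /(congr1 (fun M => \det M)) := e.
by rewrite !det_mulmx !det_ublock !det_lblock !det1 !mul1r !mulr1.
Qed.

(* Feedback through a left-invariant subspace moves only the spectrum of the
   action on that subspace. *)
Lemma det_feedback (R : comUnitRingType) (n m r : nat) (Z : 'M[R]_n)
    (Y : 'M[R]_r) (B : 'M[R]_(n, m)) (W : 'M[R]_(r, n)) (f : 'M[R]_(m, r)) :
  Z \in unitmx -> Y \in unitmx -> W *m Z = Y *m W ->
  \det (Z - B *m f *m W) * \det Y = \det Z * \det (Y - W *m B *m f).
Proof.
move=> uZ uY WZ.
have WZi : W *m invmx Z = invmx Y *m W.
  by rewrite -[LHS](mulKmx uY) (mulmxA Y) -WZ mulmxK.
have -> : Z - B *m f *m W = Z *m (1%:M - invmx Z *m (B *m f) *m W).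
  by rewrite mulmxBr mulmx1 -(mulmxA (invmx Z)) mulKVmx.
rewrite det_mulmx det_1subC !mulmxA WZi -mulrA; congr (_ * _).
by rewrite mulrC -det_mulmx mulmxBr mulmx1 -!mulmxA mulKVmx.
Qed.

Lemma char_poly_feedback (R : realType) (n m r : nat) (A : 'M[R]_n)
    (B : 'M[R]_(n, m)) (W : 'M[R]_(r, n)) (Lam : 'M[R]_r) (f : 'M[R]_(m, r)) :
  W *m A = Lam *m W ->
  char_poly (A + B *m f *m W) * char_poly Lam
  = char_poly A * char_poly (Lam + W *m B *m f).
Proof.
move=> WA; apply/eqP; rewrite -tofrac_eq !tofracM -!det_zIsub; apply/eqP.
rewrite !zIsubD !map_mxM; apply: det_feedback; rewrite ?zIsub_unit //.
by rewrite mulmxBr mulmxBl scalar_mxC -!map_mxM WA.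
Qed.

Lemma not_schur_poly (R : realType) (u : {poly R}) : ~ schur_poly u ->
  exists2 w : R[i], root (map_poly (real_complex R) u) w & 1 <= `|w|.
Proof.
move=> nu; have [//|nh] := pselect (exists2 w : R[i],
  root (map_poly (real_complex R) u) w & 1 <= `|w|).
case: nu => w rw; rewrite real_ltNge ?normr_real ?real1 //.
by apply/negP => w1; apply: nh; exists w.
Qed.

Lemma mulmx_Re (R : realType) (p q : nat) (v : 'rV[R[i]]_p) (M : 'M[R]_(p, q)) :
  map_mx (@complex.Re R) (v *m map_mx (real_complex R) M) = map_mx (@complex.Re R) v *m M.
Proof.
apply/matrixP => i j; rewrite !mxE (big_morph (@complex.Re R) (id1 := 0) (op1 := +%R)) //.
  by apply: eq_bigr => k _; rewrite !mxE; case: (v i k) => a b /=; rewrite mulr0 subr0.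
by move=> [a b] [c d].
Qed.

Lemma mulmx_Im (R : realType) (p q : nat) (v : 'rV[R[i]]_p) (M : 'M[R]_(p, q)) :
  map_mx (@complex.Im R) (v *m map_mx (real_complex R) M) = map_mx (@complex.Im R) v *m M.
Proof.
apply/matrixP => i j; rewrite !mxE (big_morph (@complex.Im R) (id1 := 0) (op1 := +%R)) //.
  by apply: eq_bigr => k _; rewrite !mxE; case: (v i k) => a b /=; rewrite mulr0 add0r.
by move=> [a b] [c d].
Qed.

Lemma det_block11 (R : comNzRingType) (a b c d : R) :
  \det (block_mx a%:M b%:M c%:M d%:M : 'M_(1 + 1)) = a * d - b * c.
Proof.
have lr : lift (lshift 1 (0 : 'I_1)) (0 : 'I_1) = rshift 1 0 :> 'I_(1 + 1) by apply: val_inj.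
have rl : lift (rshift 1 (0 : 'I_1)) (0 : 'I_1) = lshift 1 0 :> 'I_(1 + 1) by apply: val_inj.
rewrite (expand_det_row _ (lshift 1 0)) big_split_ord !big_ord1 /=.
rewrite block_mxEul block_mxEur /cofactor !det_mx11.
rewrite 2![X in a%:M 0 0 * (_ * X)]mxE 2![X in b%:M 0 0 * (_ * X)]mxE.
rewrite lr rl block_mxEdl block_mxEdr !mxE /= !mulr1n mul1r expr1.
by rewrite mulN1r mulrN.
Qed.

Lemma char_poly_block11 (R : comNzRingType) (a b c d : R) :
  char_poly (block_mx a%:M b%:M c%:M d%:M : 'M_(1 + 1))
  = 'X^2 - (a + d) *: 'X + (a * d - b * c)%:P.
Proof.
rewrite /char_poly /char_poly_mx scalar_mx_block map_block_mx opp_block_mx.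
rewrite add_block_mx !map_scalar_mx !add0r -!(raddfN (@scalar_mx _ 1)).
rewrite -!(raddfD (@scalar_mx _ 1)).
rewrite det_block11 -mul_polyC !(polyCD, polyCN, polyCM); ring.
Qed.

Lemma mulmx_scale_delta (R : comNzRingType) (m : nat) (v : 'rV[R]_m) (k : R)
    (j : 'I_m) : v *m (k *: delta_mx j 0) = (v 0 j * k)%:M :> 'M_1.
Proof. by rewrite -scalemxAr -colE [col _ _]mx11_scalar mxE scale_scalar_mx mulrC. Qed.

(** The quadratic is (X - w)(X - conj w). Its factors are coprime because w is not real, and both
    divide the real polynomial u over [R[i]]; divisibility then descends to [R]. *)
Lemma dvdp_conj_pair (R : realType) (u : {poly R}) (w : R[i]) : complex.Im w != 0 ->
  root (map_poly (real_complex R) u) w ->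
  'X^2 - (complex.Re w *+ 2) *: 'X + (complex.Re w ^+ 2 + complex.Im w ^+ 2)%:P %| u.
Proof.
move=> w0 rw; rewrite -(dvdp_map (real_complex R)).
have rw' : root (map_poly (real_complex R) u) w^*%C.
  rewrite -complex_root_conj -map_poly_comp.
  by rewrite (eq_map_poly (g := real_complex R)) // => x /=; rewrite oppr0.
have -> : map_poly (real_complex R)
    ('X^2 - (complex.Re w *+ 2) *: 'X + (complex.Re w ^+ 2 + complex.Im w ^+ 2)%:P)
    = ('X - w%:P) * ('X - (w^*%C)%:P).
  rewrite rmorphD rmorphB /= map_polyXn map_polyZ map_polyX map_polyC /=.
  have -> : real_complex R (complex.Re w *+ 2) = w + w^*%C.
    by case: w {w0 rw rw'} => a b; rewrite mulr2n; apply/eqP; rewrite eq_complex /= subrr !eqxx.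
  have -> : real_complex R (complex.Re w ^+ 2 + complex.Im w ^+ 2) = w * w^*%C.
    case: w {w0 rw rw'} => a b; apply/eqP; rewrite eq_complex /=.
    by rewrite !mulrN opprK -!expr2 eqxx [b * a]mulrC addNr eqxx.
  by rewrite -mul_polyC !(polyCD, polyCM); ring.
rewrite Gauss_dvdp ?dvdp_XsubCl ?rw //.
rewrite coprimep_XsubC root_XsubC.
apply: contraNneq w0; case: w {rw rw'} => a b /= [/eqP]; rewrite eq_sym -addr_eq0.
by rewrite -mulr2n mulrn_eq0 => /orP[].
Qed.

(** The rows of [W] span a left-invariant real subspace: a real eigenvector if w is real, otherwise
    the real and imaginary parts of a complex one. By the Hautus test some input j acts on it, and
    feedback through that input alone makes the block nilpotent. [char_poly Lam] is the minimal
    polynomial of w over [R], hence the last clause. *)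
Lemma unstable_deflation (R : realType) (n m : nat) (A : 'M[R]_n)
    (B : 'M[R]_(n, m)) (w : R[i]) : pbh_stabilizable A B ->
  1 <= `|w| -> root (map_poly (real_complex R) (char_poly A)) w ->
  exists (r : nat) (W : 'M[R]_(r, n)) (Lam : 'M[R]_r) (f : 'M[R]_(m, r)),
    [/\ (0 < r)%N, W *m A = Lam *m W, char_poly (Lam + W *m B *m f) = 'X^r
      & forall u, root (map_poly (real_complex R) u) w -> char_poly Lam %| u].
Proof.
move=> hA w1; have [w0|w0] := eqVneq (complex.Im w) 0.
  have wE : w = real_complex R (complex.Re w) by case: w w0 {w1} => a b /= ->.
  rewrite {}wE in w1 *; move: (complex.Re w) w1 => al w1.
  rewrite fmorph_root -eigenvalue_root_char => /eigenvalueP[a aA a0].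
  have [j aBj] : exists j, (a *m B) 0 j != 0.
    apply/rV0Pn; apply: contraNneq a0 => aB.
    rewrite -(map_mx_eq0 (real_complex R)); apply/eqP/(hA _ _ w1).
      by rewrite -map_mxM aA map_mxZ.
    by rewrite -map_mxM aB map_mx0.
  exists 1%N, a, al%:M, ((- al / (a *m B) 0 j) *: delta_mx j 0); split=> //.
  - by rewrite aA mul_scalar_mx.
  - rewrite mulmx_scale_delta mulrC divfK // -(raddfD (@scalar_mx _ 1)) subrr.
    by rewrite /char_poly /char_poly_mx map_scalar_mx /= polyC0 raddf0 subr0 det_scalar1 expr1.
  - move=> u; rewrite fmorph_root -dvdp_XsubCl.
    by rewrite /char_poly /char_poly_mx map_scalar_mx -(raddfB (@scalar_mx _ 1)) det_scalar1.
rewrite map_char_poly -eigenvalue_root_char => /eigenvalueP[v vA v0].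
pose x := map_mx (@complex.Re R) v; pose y := map_mx (@complex.Im R) v.
have xA : x *m A = complex.Re w *: x - complex.Im w *: y.
  by rewrite -mulmx_Re vA; apply/rowP => k; rewrite !mxE; case: (w) (v 0 k) => [? ?] [].
have yA : y *m A = complex.Im w *: x + complex.Re w *: y.
  by rewrite -mulmx_Im vA; apply/rowP => k; rewrite !mxE; case: (w) (v 0 k) => [? ?] [? ?] /=;
    rewrite addrC.
have [j vBj] : exists j, (v *m map_mx (real_complex R) B) 0 j != 0.
  by apply/rV0Pn; apply: contraNneq v0 => vB; apply/eqP/(hA _ _ w1).
set b1 := (x *m B) 0 j; set b2 := (y *m B) 0 j.
(* This is the squared modulus of the nonzero entry of vB, and up to sign the determinant of the
   linear system for the gains [k1], [k2] below. *)
have N0 : b1 ^+ 2 + b2 ^+ 2 != 0.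
  apply: contraNneq vBj => /eqP; rewrite paddr_eq0 ?sqr_ge0 // !sqrf_eq0.
  by rewrite eq_complex /b1 /b2 -mulmx_Re -mulmx_Im !mxE.
set al := complex.Re w in xA yA *; set be := complex.Im w in w0 xA yA *.
(* k1, k2 solve  b1 k1 + b2 k2 = s  and  b2 k1 - b1 k2 = t, which make the trace
   and the determinant of the deflated block vanish. *)
pose s := - (al *+ 2); pose t := (al ^+ 2 - be ^+ 2) / be.
pose k1 := (b1 * s + b2 * t) / (b1 ^+ 2 + b2 ^+ 2).
pose k2 := (b2 * s - b1 * t) / (b1 ^+ 2 + b2 ^+ 2).
exists (1 + 1)%N, (col_mx x y), (block_mx al%:M (- be)%:M be%:M al%:M),
  (row_mx (k1 *: delta_mx j 0) (k2 *: delta_mx j 0)); split=> //.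
- rewrite mul_col_mx xA yA mul_block_col !mul_scalar_mx.
  by rewrite scaleNr.
- rewrite mul_col_mx mul_col_row !mulmx_scale_delta -/b1 -/b2 add_block_mx.
  rewrite -!(raddfD (@scalar_mx _ 1)) char_poly_block11.
  have -> : al + b1 * k1 + (al + b2 * k2) = 0 by rewrite /k1 /k2 /s /t; field; apply/andP.
  have -> : (al + b1 * k1) * (al + b2 * k2) - (- be + b1 * k2) * (be + b2 * k1) = 0.
    by rewrite /k1 /k2 /s /t; field; apply/andP.
  by rewrite scale0r subr0 addr0.
- move=> u /(dvdp_conj_pair w0); rewrite char_poly_block11 -/al -/be.
  by rewrite mulNr opprK mulr2n !expr2.
Qed.

(** Induction on the size of u, a cofactor of a known Schur factor s of the characteristic
    polynomial. If u has an unstable root, one deflation trades the factor [char_poly Lam] of u for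
    'X^r, which joins s; the quotient k is the new u, smaller because r > 0. *)
Lemma pbh_static_feedback (R : realType) (n m : nat) (A : 'M[R]_n)
    (B : 'M[R]_(n, m)) : pbh_stabilizable A B -> stabilizable A B.
Proof.
suff H N (A' : 'M[R]_n) (s u : {poly R}) : (size u <= N)%N ->
    pbh_stabilizable A' B -> char_poly A' = s * u -> schur_poly s ->
    stabilizable A' B.
  move=> h; apply: (H _ _ 1 (char_poly A) (leqnn _) h); first by rewrite mul1r.
  by apply: (@schur_polyC R 1); rewrite oner_eq0.
elim: N A' s u => [|N IH] A' s u.
  rewrite leqn0 size_poly_eq0 => /eqP-> _ /eqP; rewrite mulr0.
  by rewrite (negPf (monic_neq0 (char_poly_monic _))).
move=> su hA Asu hs; have [hu|] := pselect (schur_poly u).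
  by exists 0; rewrite mulmx0 addr0 schurE Asu schur_polyM.
move=> /not_schur_poly[w rw w1].
have rwA : root (map_poly (real_complex R) (char_poly A')) w.
  by rewrite Asu rmorphM rootM rw orbT.
have [r [W [Lam [f [r0 WA fX Lu]]]]] := unstable_deflation hA w1 rwA.
have /dvdpP[k uE] := Lu u rw.
have L0 : char_poly Lam != 0 := monic_neq0 (char_poly_monic _).
have u0 : u != 0.
  by apply: contraTneq (char_poly_monic A') => u0; rewrite Asu u0 mulr0 monicE
    lead_coef0 eq_sym oner_eq0.
have k0 : k != 0 by apply: contraNneq u0; rewrite uE => ->; rewrite mul0r.
have /IH : (size k <= N)%N.
  rewrite -ltnS; apply: leq_trans su; rewrite uE size_mul // size_char_poly.
  by rewrite addnS /= -addn1 leq_add2l.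
move=> /(_ (A' + B *m f *m W) (s * 'X^r)) [].
(* The Hautus test survives feedback: a row v with vB = 0 does not see the added term. *)
- move=> z v z1 vA vB; apply: (hA z v) => //; rewrite -vA.
  by rewrite map_mxD !map_mxM mulmxDr !mulmxA vB !mul0mx addr0.
- apply: (mulIf L0); rewrite (char_poly_feedback _ _ WA) fX Asu uE.
  by rewrite -!mulrA; congr (_ * _); rewrite [RHS]mulrC mulrA.
- by apply/schur_polyM; split=> //; apply: schur_polyXn.
by move=> F hF; exists (f *m W + F); rewrite mulmxDr mulmxA addrA.
Qed.

(** * State-space realizations of stable proper transfer matrices *)

Lemma realizationP (R : realType) (n m k : nat) (K : 'M[ratfun R]_(m, n))
    (Ak : 'M[R]_k) (Bk : 'M[R]_(k, n)) (Ck : 'M[R]_(m, k)) (Dk : 'M[R]_(m, n)) :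
  realization K Ak Bk Ck Dk <->
  exists2 S, zIsub Ak *m S = cmx Bk & K = cmx Ck *m S + cmx Dk.
Proof.
split=> [->|[S SE ->]].
  exists (invmx (zIsub Ak) *m cmx Bk); last by rewrite mulmxA.
  by rewrite mulKVmx ?zIsub_unit.
by rewrite /realization -SE -mulmxA mulKmx ?zIsub_unit.
Qed.

Definition schur_realizable (R : realType) (a b : nat)
    (G : 'M[ratfun R]_(a, b)) : Prop :=
  exists (k : nat) (Ak : 'M[R]_k) (Bk : 'M[R]_(k, b)) (Ck : 'M[R]_(a, k))
         (Dk : 'M[R]_(a, b)), realization G Ak Bk Ck Dk /\ schur Ak.

Lemma schur_realizable0 (R : realType) (a b : nat) :
  schur_realizable (0 : 'M[ratfun R]_(a, b)).
Proof.
exists 0%N, 0, 0, 0, 0; split; last exact: schur0.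
by apply/realizationP; exists 0; rewrite !map_mx0 ?mul0mx ?mulmx0 ?addr0.
Qed.

Lemma schur_realizableD (R : realType) (a b : nat) (G H : 'M[ratfun R]_(a, b)) :
  schur_realizable G -> schur_realizable H -> schur_realizable (G + H).
Proof.
move=> [k [Ak [Bk [Ck [Dk [/realizationP[S SE ->] sA]]]]]].
move=> [l [Al [Bl [Cl [Dl [/realizationP[T TE ->] sB]]]]]].
exists (k + l)%N, (block_mx Ak 0 0 Al), (col_mx Bk Bl), (row_mx Ck Cl), (Dk + Dl).
split; last exact: schur_ublock.
apply/realizationP; exists (col_mx S T).
  rewrite zIsub_block !map_mx0 !oppr0 mul_block_col !mul0mx addr0 add0r.
  by rewrite SE TE map_col_mx.
by rewrite map_row_mx mul_row_col map_mxD addrACA.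
Qed.

Lemma schur_realizable_cstM (R : realType) (a b c d : nat)
    (M : 'M[R]_(a, b)) (G : 'M[ratfun R]_(b, c)) (N : 'M[R]_(c, d)) :
  schur_realizable G -> schur_realizable (cmx M *m G *m cmx N).
Proof.
move=> [k [Ak [Bk [Ck [Dk [/realizationP[S SE ->] sA]]]]]].
exists k, Ak, (Bk *m N), (M *m Ck), (M *m Dk *m N); split=> //.
apply/realizationP; exists (S *m cmx N); first by rewrite mulmxA SE map_mxM.
by rewrite !map_mxM mulmxDr mulmxDl !mulmxA.
Qed.

Lemma tofrac_sum (R : realType) (k : nat) (p : {poly R}) : (size p <= k)%N ->
  tofrac p = \sum_(j < k) cst p`_j * zvar R ^+ j.
Proof.
move=> sp; have {1}-> : p = \poly_(i < k) p`_i.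
  apply/polyP => i; rewrite coef_poly; case: ltnP => // ki.
  by rewrite nth_default // (leq_trans sp).
rewrite poly_def rmorph_sum; apply: eq_bigr => j _.
by rewrite -mul_polyC rmorphM rmorphXn.
Qed.

(** Shows that the resolvent of the companion matrix sends the last basis vector to the column of
    powers of z divided by q. The matrix has dimension [(size q).-1], so [(size q).-2] indexes its
    last row, which carries the negated coefficients of q; the other rows are shifts. *)
Lemma companion_zvar (R : realType) (q : {poly R}) : q \is monic ->
  zIsub (companionmx q) *m (\col_i zvar R ^+ i)
  = tofrac q *: cmx (\col_i (i == (size q).-2 :> nat)%:R).
Proof.
move=> qm; have sq : size q = (size q).-1.+1.
  by rewrite prednK // size_poly_gt0 monic_neq0.
apply/matrixP => i o; rewrite mulmxBl mul_scalar_mx !mxE -exprS.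
have [iE|iN] := eqVneq (i : nat) (size q).-2.
  rewrite rmorph1 mulr1 (@tofrac_sum _ (size q).-1.+1); last by rewrite -sq.
  rewrite big_ord_recr /=.
  have -> : q`_(size q).-1 = 1 by rewrite -[LHS]/(lead_coef q) (eqP qm).
  rewrite rmorph1 mul1r iE prednK; last by case: (size q).-1 i {iE} => [[]|].
  rewrite addrC; congr (_ + _); rewrite -sumrN; apply: eq_bigr => j _.
  by rewrite !mxE iE eqxx rmorphN mulNr opprK.
rewrite rmorph0 mulr0; have ik : (i.+1 < (size q).-1)%N.
  by rewrite ltn_neqAle ltn_ord andbT; apply: contraNneq iN => e; apply/eqP;
    rewrite -[LHS]/(i.+1.-1) e.
rewrite (bigD1 (Ordinal ik)) //= big1 => [|j jN].
  by rewrite !mxE (negPf iN) /= eqxx rmorph1 mul1r addr0 subrr.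
rewrite !mxE (negPf iN); case: eqP => [e|_]; last by rewrite rmorph0 mul0r.
by case/eqP: jN; apply: val_inj.
Qed.

(** Controllable canonical form: after normalization to a monic denominator, the state matrix is the
    companion matrix, whose characteristic polynomial is q. *)
Lemma RHfun_realizable (R : realType) (f : ratfun R) :
  RHfun f -> schur_realizable (f%:M : 'M_1).
Proof.
move=> [p0 [q0 [hq0 sz0 fE0]]]; have q00 := schur_poly_neq0 hq0.
have l0 : lead_coef q0 != 0 by rewrite lead_coef_eq0.
pose p := (lead_coef q0)^-1 *: p0; pose q := (lead_coef q0)^-1 *: q0.
have qm : q \is monic by rewrite monicE lead_coefZ mulVf.
have hq : schur_poly q.
  by rewrite /q -mul_polyC; apply/schur_polyM; split=> //; apply: schur_polyC;
    rewrite invr_eq0.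
have sz : (size p <= size q)%N by rewrite !size_scale ?invr_eq0.
have tq : tofrac q != 0 by rewrite tofrac_eq0 monic_neq0.
have fE : f = tofrac p / tofrac q.
  have l0' : tofrac (lead_coef q0)^-1%:P != 0.
    by rewrite tofrac_eq0 polyC_eq0 invr_eq0.
  rewrite fE0 /p /q -(mul_polyC _ p0) -(mul_polyC _ q0) !tofracM.
  by rewrite -mulf_div (divff l0') mul1r.
move: p q qm hq sz tq fE => p q qm hq sz tq fE.
(* [d] is the value of f at infinity, the direct feedthrough; subtracting it leaves the strictly
   proper part p1 / q. *)
pose d := p`_(size q).-1; pose p1 := p - d *: q.
have sp1 : (size p1 <= (size q).-1)%N.
  apply/leq_sizeP => j; rewrite leq_eqVlt => /predU1P[<-|lj].
    by rewrite !coefE -lead_coefE (eqP qm) mulr1 subrr.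
  have sj : (size q <= j)%N by apply: leq_trans lj; rewrite leqSpred.
  by rewrite !coefE !nth_default ?mulr0 ?subr0 // (leq_trans sz).
exists (size q).-1, (companionmx q), (\col_i (i == (size q).-2 :> nat)%:R),
  (\row_i p1`_i), d%:M; split; last by rewrite schurE companionmxK.
apply/realizationP; exists ((tofrac q)^-1 *: \col_i zvar R ^+ i).
  by rewrite -scalemxAr companion_zvar // scalerA mulVf // scale1r.
rewrite -scalemxAr map_scalar_mx.
have -> : cmx (\row_(i < (size q).-1) p1`_i) *m (\col_i zvar R ^+ i) = (tofrac p1)%:M :> 'M_1.
  apply/matrixP => r c; rewrite !ord1 !mxE mulr1n (tofrac_sum sp1).
  by apply: eq_bigr => j _; rewrite !mxE.
rewrite scale_scalar_mx -raddfD; congr (_%:M).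
rewrite /p1 tofracB -mul_polyC tofracM fE mulrBr mulrC [X in _ - X]mulrC mulfK //.
by rewrite subrK.
Qed.

(** Entries are realized separately, put in place by constant delta matrices and connected in
    parallel; the state matrix stays block diagonal with Schur blocks. *)
Lemma RHinf_realizable (R : realType) (a b : nat) (G : 'M[ratfun R]_(a, b)) :
  RHinf G -> schur_realizable G.
Proof.
move=> /RHinfP hG; rewrite [G]matrix_sum_delta.
apply: big_ind; [exact: schur_realizable0 | exact: schur_realizableD | move=> i _].
apply: big_ind; [exact: schur_realizable0 | exact: schur_realizableD | move=> j _].
have -> : G i j *: delta_mx i j
    = cmx (delta_mx i 0) *m (G i j)%:M *m cmx (delta_mx (0 : 'I_1) j).
  by rewrite !map_delta_mx mul_mx_scalar -scalemxAl mul_delta_mx.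
exact/schur_realizable_cstM/RHfun_realizable.
Qed.

(** * A stabilizing controller with a prescribed response *)

Lemma youla_state_eq (R : comNzRingType) (n m : nat) (z : R) (A Y : 'M[R]_n)
    (B : 'M[R]_(n, m)) (F D U V : 'M[R]_(m, n)) :
  z%:M *m Y = A *m Y + B *m U + z%:M -> V = U - F *m (Y - 1%:M) - D ->
  (z%:M - B *m (F - D)) *m (Y - 1%:M) - B *m V = (A + B *m D) *m Y.
Proof.
move=> YE ->; rewrite mulmxBl [z%:M *m _]mulmxBr mulmx1 YE.
rewrite !(mulmxBr, mulmxBl, mulmxDl, mulmx1, mulNmx, mulmxA).
move: (A *m Y) (B *m U) (B *m F *m Y) (B *m F) (B *m D *m Y) (B *m D) => a b c d e f.
by apply/matrixP => i j; rewrite !(mxE, mulmxN); ring.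
Qed.

(** This identity and the preceding one are the output equation and the xhat-row of the state
    equation of the controller under the disturbance zI. There x = Y, u = U and x - xhat = I, so
    xhat = Y - I, and V = Q - D is the strictly proper part of Q. *)
Lemma youla_output_eq (R : comNzRingType) (n m : nat) (Y : 'M[R]_n)
    (F D U V : 'M[R]_(m, n)) :
  V = U - F *m (Y - 1%:M) - D -> (F - D) *m (Y - 1%:M) + V + D *m Y = U.
Proof.
move=> ->; rewrite mulmxBl !mulmxBr !mulmx1.
move: (F *m Y) (D *m Y) => a b.
by apply/matrixP => i j; rewrite !mxE; ring.
Qed.

Lemma affine_subspace_controller (R : realType) (n m : nat) (A : 'M[R]_n)
    (B2 : 'M[R]_(n, m)) (Phix : 'M[ratfun R]_n) (Phiu : 'M[ratfun R]_(m, n)) :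
  affine_subspace A B2 Phix Phiu ->
  exists K, internally_stabilizing A B2 K /\ system_response A B2 K Phix Phiu.
Proof.
move=> aff; have [F sF] := pbh_static_feedback (affine_subspace_pbh aff).
case: aff; rewrite affine_subspaceE => aff hx hu.
pose Y := zvar R *: Phix; pose U := zvar R *: Phiu.
have hQ : RHinf (U - cmx F *m (Y - 1%:M)).
  apply: RHinfD => //; apply: RHinfN; apply: RHinfM; first exact: RHinf_cst.
  by apply: RHinfD => //; apply: RHinfN; apply: RHinf1.
have [k [Aq [Bq [Cq [Dq [/realizationP[S SE QE] sA]]]]]] := RHinf_realizable hQ.
have YE : (zvar R)%:M *m Y = cmx A *m Y + cmx B2 *m U + (zvar R)%:M.
  have /(congr1 ( *:%R (zvar R))) := aff.
  rewrite scalerBr !scalemxAr -/Y -/U mulmxBl => /eqP; rewrite !subr_eq.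
  by rewrite scale_scalar_mx mulr1 => /eqP->; rewrite addrC [X in _ + X]addrC addrA.
(* Obtained from xhat[t+1] = A x + B2 u, q[t+1] = Aq q + Bq (x - xhat), u = F xhat + Cq q + Dq (x -
   xhat) by eliminating u and collecting xhat, q and x. *)
pose Ak := block_mx (B2 *m (F - Dq)) (B2 *m Cq) (- Bq) Aq.
pose Bk := col_mx (A + B2 *m Dq) Bq; pose Ck := row_mx (F - Dq) Cq.
pose K := cmx Ck *m invmx (zIsub Ak) *m cmx Bk + cmx Dq.
have KR : realization K Ak Bk Ck Dq by [].
have sV : schur (block_mx (A + B2 *m F) (B2 *m Cq) 0 Aq) by apply: schur_ublock.
have CS : cmx Cq *m S = U - cmx F *m (Y - 1%:M) - cmx Dq by rewrite QE addrK.
have KY : K *m Y = U.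
  (* Driven by x = Y, the controller state (xhat, q) is (Y - I, S). *)
  have XE : zIsub Ak *m col_mx (Y - 1%:M) S = cmx Bk *m Y.
    rewrite zIsub_block mul_block_col map_col_mx mul_col_mx; congr col_mx.
      rewrite mulNmx (map_mxM _ B2 Cq) -mulmxA /zIsub map_mxM map_mxB map_mxD map_mxM.
      exact: youla_state_eq YE CS.
    by rewrite map_mxN opprK mulmxBr mulmx1 SE subrK.
  have uAk := zIsub_unit Ak.
  rewrite /K mulmxDl -mulmxA -XE -(mulmxA (cmx Ck)) (mulKmx uAk).
  by rewrite map_row_mx mul_row_col map_mxB; apply: youla_output_eq CS.
have KPx : K *m Phix = Phiu.
  have /(congr1 ( *:%R (zvar R)^-1)) := KY.
  by rewrite -!scalemxAr !scalerA mulVf ?zvar_neq0 // !scale1r.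
have MPx : (zIsub A - cmx B2 *m K) *m Phix = 1%:M.
  by rewrite mulmxBl -mulmxA KPx.
have [uM _] := mulmx1_unit MPx.
have PxE : Phix = invmx (zIsub A - cmx B2 *m K).
  by rewrite -[LHS](mulKmx uM) MPx mulmx1.
exists K; split; last by split=> //; rewrite -PxE.
exists (n + k)%N, Ak, Bk, Ck, Dq; split=> //.
- exists (row_mx 1%:M 0); suff -> : Ak + Bk *m row_mx 1%:M 0
    = block_mx (A + B2 *m F) (B2 *m Cq) 0 Aq by [].
  rewrite mul_col_row !mulmx1 !mulmx0 add_block_mx !addr0 addNr.
  by rewrite addrC -addrA -mulmxDr [Dq + _]addrC subrK.
- exists (col_mx (- B2) 0); suff -> : Ak + col_mx (- B2) 0 *m Ck
    = block_mx 0 0 (- Bq) Aq by apply: schur_lblock; first exact: schur0.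
  by rewrite mul_col_row !mulNmx !mul0mx add_block_mx !subrr !addr0.
(* [T] maps (x, xhat, q) to (x - xhat, xhat, q). The top row of [N] is 0 because x and xhat have the
   same undisturbed update. *)
pose T : 'M[R]_(n + (n + k)) := block_mx 1%:M (row_mx (- 1%:M) 0) 0 1%:M.
pose N : 'M[R]_(n + (n + k)) :=
  block_mx 0 0 Bk (block_mx (A + B2 *m F) (B2 *m Cq) 0 Aq).
apply: (@schur_conj _ _ T _ N).
- by rewrite unitmxE det_ublock !det1 mulr1 unitr1.
- rewrite /closed_loop_matrix !mulmx_block !(mul1mx, mul0mx, mulmx1, mulmx0).
  rewrite !(add0r, addr0) mul_row_col mul_row_block mul_mx_row mul_col_row.
  rewrite !(mul0mx, mulNmx, mul1mx, mulmxN, mulmx1, mulmx0) !(addr0, add0r).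
  rewrite add_row_mx !subrr row_mx0 add_block_mx !add0r; congr block_mx.
  by rewrite addr0 opprD addrACA addNr add0r addrC -mulmxBr.
- by apply: schur_lblock; first exact: schur0.
Qed.

(** * The implementation and its closed-loop maps *)

Lemma implementation_perturbed (L : fieldType) (n m : nat) (z : L)
    (Z Px : 'M[L]_n) (B : 'M[L]_(n, m)) (Pu : 'M[L]_(m, n))
    (dx dy x d : 'cV[L]_n) (du u : 'cV[L]_m) :
  z != 0 -> Z *m Px - B *m Pu = 1%:M ->
  let v := dx + Z *m dy + B *m du in
  [/\ Z *m x = B *m u + dx, u = z *: Pu *m d + du
    & d = x + dy + (1%:M - z *: Px) *m d] <->
  [/\ x = Px *m v - dy, u = Pu *m v + du & d = z^-1 *: v].
Proof.
move=> z0 aff v.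
have ZPx : Z *m Px = 1%:M + B *m Pu by rewrite -aff subrK.
split=> [[xE uE dE] | [-> -> ->]].
  (* In the third loop equation d cancels, leaving x + dy = z Px d. Substituted into the plant
     equation with Z Px = 1 + B Pu, this yields z d = v. *)
  have xdE : x = Px *m (z *: d) - dy.
    apply: (canRL (addrK dy)); apply: (addIr ((1%:M - z *: Px) *m d)).
    by rewrite -dE mulmxBl mul1mx -scalemxAl scalemxAr addrC subrK.
  have {}uE : u = Pu *m (z *: d) + du by rewrite uE -scalemxAl scalemxAr.
  suff vE : z *: d = v by rewrite -vE scalerA mulVf // scale1r.
  have : Z *m x = z *: d + B *m (Pu *m (z *: d)) - Z *m dy.
    by rewrite xdE mulmxBr (mulmxA Z) ZPx mulmxDl mul1mx (mulmxA B).
  rewrite xE uE mulmxDr /v; move: (z *: d) (B *m (Pu *m _)) (B *m du) (Z *m dy).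
  move=> e a b c /eqP; rewrite eq_sym subr_eq [_ + a]addrC -!addrA.
  by move=> /eqP/addrI ->; rewrite addrC addrA.
have zv : z *: (z^-1 *: v) = v by rewrite scalerA mulfV // scale1r.
split.
- rewrite mulmxBr (mulmxA Z) ZPx mulmxDl mul1mx mulmxDr (mulmxA B Pu).
  move: (B *m Pu *m v) => a; rewrite /v; move: (B *m du) (Z *m dy) => b c.
  by apply/matrixP => i j; rewrite !mxE; ring.
- by rewrite -scalemxAl scalemxAr zv.
- by rewrite mulmxBl mul1mx -scalemxAl scalemxAr zv subrK addrC subrK.
Qed.

Lemma affine_subspace_implementation (R : realType) (n m : nat) (A : 'M[R]_n)
    (B2 : 'M[R]_(n, m)) (Phix : 'M[ratfun R]_n) (Phiu : 'M[ratfun R]_(m, n)) :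
  affine_subspace A B2 Phix Phiu ->
     [/\ Phix \in unitmx,
         implements Phix Phiu (Phiu *m invmx Phix),
         implementation_internally_stable A B2 Phix Phiu
       & achieves_response A B2 Phix Phiu].
Proof.
move=> aff; have [K [_ [uM PxE _]]] := affine_subspace_controller aff.
have uPx : Phix \in unitmx by rewrite PxE unitmx_inv.
case: aff; rewrite affine_subspaceE => aff hx hu.
have [hx' hu'] := (zinvRHinf_RHinf hx, zinvRHinf_RHinf hu).
have affL (L : fieldType) (iota : {rmorphism ratfun R -> L}) :
    map_mx iota (zIsub A) *m map_mx iota Phix
    - map_mx iota (cmx B2) *m map_mx iota Phiu = 1%:M.
  by rewrite -!map_mxM -map_mxB aff map_mx1.
have z0 (L : fieldType) (iota : {rmorphism ratfun R -> L}) : iota (zvar R) != 0.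
  by rewrite fmorph_eq0 zvar_neq0.
have loopP (L : fieldType) (iota : {rmorphism ratfun R -> L}) dx dy du x u d :
    perturbed_loop iota A B2 Phix Phiu dx dy du x u d <->
    let v := dx + tfapp iota (zIsub A) dy + tfapp iota (cmx B2) du in
    [/\ x = tfapp iota Phix v - dy, u = tfapp iota Phiu v + du
       & d = (iota (zvar R))^-1 *: v].
  rewrite /perturbed_loop /tfapp (map_mxB _ 1%:M) map_mx1 !map_mxZ.
  exact: implementation_perturbed (z0 L iota) (affL L iota).
have zA : RHinf ((zvar R)^-1 *: zIsub A).
  rewrite scalerBr scale_scalar_mx mulVf ?zvar_neq0 //.
  apply: RHinfD; first exact: RHinf1.
  by apply: RHinfN; apply: RHinfZ (RHfun_zvarV R) _; apply: RHinf_cst.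
(* zI - A is improper, but G is strictly proper: G (zI - A) = (zG)(I - A/z), a product of two stable
   proper factors. *)
have mulZ (a : nat) (G : 'M[ratfun R]_(a, n)) : zinvRHinf G -> RHinf (G *m zIsub A).
  move=> hG; have := RHinfM hG zA.
  by rewrite -scalemxAl -scalemxAr scalerA mulfV ?zvar_neq0 // scale1r.
split=> //.
- move=> L iota x u; rewrite /implementation /tfapp map_mxM map_invmx.
  have uP : map_mx iota Phix \in unitmx by rewrite map_unitmx.
  rewrite (map_mxB _ 1%:M) map_mx1 !map_mxZ.
  (* The estimator equation amounts to z Phix dhat = x, so dhat = Phix^-1 x / z, the witness used
     for the converse below. *)
  have dP d : d = x + (1%:M - iota (zvar R) *: map_mx iota Phix) *m d <->
      map_mx iota Phix *m (iota (zvar R) *: d) = x.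
    rewrite mulmxBl mul1mx -scalemxAl scalemxAr; split=> [e|<-].
      by apply: (addIr (d - map_mx iota Phix *m (iota (zvar R) *: d)));
        rewrite -e addrC subrK.
    by rewrite addrC subrK.
  split=> [[d [-> /dP <-]]|->].
    by rewrite -mulmxA mulKmx // -scalemxAl scalemxAr.
  exists ((iota (zvar R))^-1 *: (invmx (map_mx iota Phix) *m x)).
  split; last by apply/dP; rewrite scalerA mulfV ?z0 // scale1r mulKVmx.
  by rewrite -scalemxAl scalemxAr scalerA mulfV ?z0 // scale1r mulmxA.
(* The nine maps are the coefficients of dx, dy, du in Phix v - dy, Phiu v + du and v / z, where v =
   dx + (zI - A) dy + B2 du. *)
- exists Phix, (Phix *m zIsub A - 1%:M), (Phix *m cmx B2).
  exists Phiu, (Phiu *m zIsub A), (Phiu *m cmx B2 + 1%:M).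
  exists (zvar R)^-1%:M, ((zvar R)^-1 *: zIsub A), ((zvar R)^-1 *: cmx B2).
  split; last first.
    split; [split=> // | split; split=> //].
    + by apply: RHinfD; [exact: mulZ | apply: RHinfN; exact: RHinf1].
    + by apply: RHinfM => //; apply: RHinf_cst.
    + exact: mulZ.
    + by apply: RHinfD; [apply: RHinfM => //; exact: RHinf_cst | exact: RHinf1].
    + by rewrite -scalemx1; apply: RHinfZ (RHfun_zvarV R) (@RHinf1 R n).
    + exact: RHinfZ (RHfun_zvarV R) (RHinf_cst B2).
  move=> L iota dx dy du x u d; rewrite loopP /tfapp /=; move: (zIsub A) => Z.
  rewrite !(map_mxB, map_mxD, map_mxM, map_mx1, map_scalar_mx, map_mxZ) /= fmorphV.
  rewrite !(mulmxDr, mulmxDl, mulmxBl, mul1mx, mul_scalar_mx, scalerDr, mulmxA).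
  by rewrite -!scalemxAl mulNmx mul1mx !addrA (addrAC _ (- dy)).
move=> L iota dx x u d xE [uE dE].
have /loopP : perturbed_loop iota A B2 Phix Phiu dx 0 0 x u d.
  by split; rewrite ?addr0.
by rewrite /tfapp !mulmx0 !addr0 subr0 => -[].
Qed.

Theorem theorem4p1 (R : realType) (n m : nat)
    (A : 'M[R]_n) (B2 : 'M[R]_(n, m)) :
  (forall (Phix : 'M[ratfun R]_n) (Phiu : 'M[ratfun R]_(m, n)),
     affine_subspace A B2 Phix Phiu <->
     exists K : 'M[ratfun R]_(m, n),
       internally_stabilizing A B2 K /\ system_response A B2 K Phix Phiu)
  /\
  (forall (Phix : 'M[ratfun R]_n) (Phiu : 'M[ratfun R]_(m, n)),
     affine_subspace A B2 Phix Phiu ->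
     [/\ Phix \in unitmx,
         implements Phix Phiu (Phiu *m invmx Phix),
         implementation_internally_stable A B2 Phix Phiu
       & achieves_response A B2 Phix Phiu]).
Proof.
split=> [Phix Phiu | Phix Phiu]; last exact: affine_subspace_implementation.
split=> [|[K [hK [uM -> ->]]]]; first exact: affine_subspace_controller.
have [hx hu] := closed_loop_response hK uM.
by split=> //; rewrite affine_subspaceE mulmxA -mulmxBl mulmxV.
Qed.
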